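(* A formula $\varphi\in\mathcal L_\Diamond$ is satisfiable (respectively, falsifiable) over the class of dynamic posets if and only if it is satisfiable (respectively, falsifiable) over the class of dynamical systems.
   Context: Syntax: fix a countably infinite set $\mathbb P$ of propositional variables; $\mathcal L_\Diamond$ is given by $\varphi ::= \bot \mid p \mid \varphi\wedge\varphi \mid \varphi\vee\varphi \mid \varphi\to\varphi \mid \circ\varphi \mid \Diamond\varphi$ with $p\in\mathbb P$. Semantics: a dynamical system is $(X,\mathcal T,f)$ with $(X,\mathcal T)$ a topological space and $f\colon X\to X$ continuous. A valuation assigns to each formula an open set with $[\![\bot]\!]=\varnothing$, $[\![\varphi\wedge\psi]\!]=[\![\varphi]\!]\cap[\![\psi]\!]$, $[\![\varphi\vee\psi]\!]=[\![\varphi]\!]\cup[\![\psi]\!]$, $[\![\varphi\to\psi]\!]=\big((X\setminus[\![\varphi]\!])\cup[\![\psi]\!]\big)^\circ$, $[\![\circ\varphi]\!]=f^{-1}[\![\varphi]\!]$, $[\![\Diamond\varphi]\!]=\bigcup_{n<\omega}f^{-n}[\![\varphi]\!]$. A dynamic (expanding) poset is a dynamical system whose topology is the up-set topology of a partial order $\preccurlyeq$ (open sets are the upward closed sets), so that $f$ is a monotone map. $\varphi$ is satisfiable (falsifiable) over a class if there are a system in the class, a valuation on it and a point $x$ with $x\in[\![\varphi]\!]$ (respectively $x\notin[\![\varphi]\!]$). *)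

(* Defs.v *)
From Stdlib Require Import Arith.

Set Implicit Arguments.

Definition var := nat.

Inductive form : Type :=
| Bot : form
| Var : var -> form
| And : form -> form -> form
| Or : form -> form -> form
| Imp : form -> form -> form
| Next : form -> form
| Dia : form -> form.

Record topology (X : Type) := Topology {
  is_open : (X -> Prop) -> Prop;
  open_empty : is_open (fun _ => False);
  open_full : is_open (fun _ => True);
  open_inter : forall U V, is_open U -> is_open V -> is_open (fun x => U x /\ V x);
  open_union : forall F : (X -> Prop) -> Prop,
      (forall U, F U -> is_open U) -> is_open (fun x => exists U, F U /\ U x)
}.

Record dsystem := DSystem {
  carrier : Type;
  top : topology carrier;
  dmap : carrier -> carrier;
  dmap_cont : forall U, is_open top U -> is_open top (fun x => U (dmap x))
}.

Definition interior (X : Type) (T : topology X) (A : X -> Prop) : X -> Prop :=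
  fun x => exists U, is_open T U /\ U x /\ (forall y, U y -> A y).

Definition valuation (D : dsystem) := var -> carrier D -> Prop.
Definition open_valuation (D : dsystem) (V : valuation D) : Prop :=
  forall p, is_open (top D) (V p).

Fixpoint sem (D : dsystem) (V : valuation D) (phi : form) : carrier D -> Prop :=
  match phi with
  | Bot => fun _ => False
  | Var p => V p
  | And a b => fun x => sem V a x /\ sem V b x
  | Or a b => fun x => sem V a x \/ sem V b x
  | Imp a b => interior (top D) (fun x => ~ sem V a x \/ sem V b x)
  | Next a => fun x => sem V a (dmap D x)
  | Dia a => fun x => exists n : nat, sem V a (Nat.iter n (dmap D) x)
  end.

(* Dynamic (expanding) poset: the topology is the up-set topology of a
   partial order (the map is then automatically monotone, by continuity). *)
Definition partial_order (X : Type) (le : X -> X -> Prop) : Prop :=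
  (forall x, le x x) /\
  (forall x y, le x y -> le y x -> x = y) /\
  (forall x y z, le x y -> le y z -> le x z).

Definition upset (X : Type) (le : X -> X -> Prop) (U : X -> Prop) : Prop :=
  forall x y, le x y -> U x -> U y.

Definition dynamic_poset (D : dsystem) : Prop :=
  exists le : carrier D -> carrier D -> Prop,
    partial_order le /\
    (forall U, is_open (top D) U <-> upset le U) /\
    (forall x y, le x y -> le (dmap D x) (dmap D y)).

Definition all_systems (D : dsystem) : Prop := True.

Definition satisfiable_in (C : dsystem -> Prop) (phi : form) : Prop :=
  exists D : dsystem, C D /\
    exists V : valuation D, open_valuation V /\ exists x, sem V phi x.

Definition falsifiable_in (C : dsystem -> Prop) (phi : form) : Prop :=
  exists D : dsystem, C D /\
    exists V : valuation D, open_valuation V /\ exists x, ~ sem V phi x.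

(* Main.v *)
From Stdlib Require Import ZArith Lia List Classical.
Require Import Defs.

(** Given a system [X], the points of the poset are pairs [(x, h)] where [x] is
    a point of [X] and [h] is the number of steps for which [(x, h)] remembers
    the truths of the orbit of [x]: variables hold at [(x, h)] only if [h > 0],
    and the map sends [(x, h)] to [(f x, h - 1)].  A true [Dia] formula needs
    only a finite horizon, while a false one stays false when truths are
    forgotten.  A point [(y, k)] lies above [(x, h)] when [h < k], the orbit of
    [y] stays close to that of [x] for [h] steps, and during these steps [k]
    suffices to witness everything true along the orbit of [y].  Closeness for
    finitely many steps is an open condition on [y], so false implications
    still find their counterexamples.  Once [h] has run out, the two orbits may
    diverge freely. *)

Import ListNotations.
Local Open Scope Z_scope.

Fixpoint subforms (phi : form) : list form :=
  phi :: match phi with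
         | Bot | Var _ => []
         | And a b | Or a b | Imp a b => subforms a ++ subforms b
         | Next a | Dia a => subforms a
         end.

Lemma subforms_refl phi : In phi (subforms phi).
Proof. destruct phi; now left. Qed.

Lemma subforms_trans phi psi chi :
  In psi (subforms phi) -> In chi (subforms psi) -> In chi (subforms phi).
Proof.
  induction phi; simpl; intros [<-|H] Hchi; try exact Hchi; try tauto;
    right; rewrite ?in_app_iff in *; tauto.
Qed.

(** * Interiors and finite intersections *)

Section Interior.

Context (X : Type) (T : topology X).

Lemma interior_mono (A B : X -> Prop) x :
  (forall y, A y -> B y) -> interior T A x -> interior T B x.
Proof. intros AB (U & oU & Ux & UA). exists U; eauto. Qed.

Lemma interior_full (A : X -> Prop) x : (forall y, A y) -> interior T A x.
Proof. intros HA. exists (fun _ => True); auto using open_full. Qed.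

Lemma interior_inter (A B : X -> Prop) x :
  interior T A x -> interior T B x -> interior T (fun y => A y /\ B y) x.
Proof.
  intros (U & oU & Ux & UA) (W & oW & Wx & WB).
  exists (fun y => U y /\ W y); repeat split; try tauto.
  - now apply open_inter.
  - now apply UA.
  - now apply WB.
Qed.

Lemma interior_forall_in (I : Type) (l : list I) (A : I -> X -> Prop) x :
  (forall i, In i l -> interior T (A i) x) ->
  interior T (fun y => forall i, In i l -> A i y) x.
Proof.
  induction l as [|i l IH]; intros H.
  - apply interior_full. intros y j [].
  - apply interior_mono with (A := fun y => A i y /\ forall j, In j l -> A j y).
    + intros y [Hi Hl] j [<-|Hj]; auto.
    + apply interior_inter; [apply H; now left | apply IH; intros; apply H; now right].
Qed.

Lemma interior_forall_lt (A : nat -> X -> Prop) x n :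
  (forall i, interior T (A i) x) ->
  interior T (fun y => forall i, (i < n)%nat -> A i y) x.
Proof.
  intros H. apply interior_mono with (A := fun y => forall i, In i (seq 0 n) -> A i y).
  - intros y Hy i Hi. apply Hy, in_seq. lia.
  - apply interior_forall_in. auto.
Qed.

End Interior.

(** * Truth sets and sufficient horizons *)

Section Horizon.

Context (D : dsystem) (V : valuation D).

Local Notation f := (dmap D).

Lemma interior_preimage_iter (A : carrier D -> Prop) n x :
  interior (top D) A (Nat.iter n f x) ->
  interior (top D) (fun y => A (Nat.iter n f y)) x.
Proof.
  intros (U & oU & Ux & UA). exists (fun y => U (Nat.iter n f y)).
  split; [|auto]. clear x Ux UA. revert U oU.
  induction n as [|n IH]; intros U oU; [exact oU|].
  exact (IH (fun y => U (f y)) (dmap_cont D U oU)).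
Qed.

(** Stated with [interior] rather than [is_open]: the open sets of a [topology]
    need not respect extensional equality of predicates. *)
Lemma sem_interior (oV : open_valuation V) phi x :
  sem V phi x -> interior (top D) (sem V phi) x.
Proof.
  revert x; induction phi as [|p|a IHa b IHb|a IHa b IHb|a IHa b IHb|a IHa|a IHa];
    simpl; intros x H.
  - destruct H.
  - exists (V p); auto.
  - apply interior_inter; firstorder.
  - destruct H; [apply interior_mono with (A := sem V a) | apply interior_mono with (A := sem V b)];
      auto.
  - destruct H as (U & oU & Ux & UA). exists U. repeat split; auto.
    intros y Uy. exists U; auto.
  - exact (interior_preimage_iter _ 1 _ (IHa _ H)).
  - destruct H as [n H].
    eapply interior_mono; [|exact (interior_preimage_iter _ n _ (IHa _ H))].
    intros y Hy. now exists n.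
Qed.

(** A sufficient condition for truth at [(x, h)] in the poset. In the [Imp] clause, [0 < h] lets
    strictly higher points be compared with [x] at step 0, and the last conjunct covers [(x, h)]
    itself. *)
Fixpoint witnessed (phi : form) (x : carrier D) (h : Z) : Prop :=
  match phi with
  | Bot => False
  | Var p => V p x /\ 0 < h
  | And a b => witnessed a x h /\ witnessed b x h
  | Or a b => witnessed a x h \/ witnessed b x h
  | Imp a b => sem V (Imp a b) x /\ 0 < h /\ (sem V b x -> witnessed b x h)
  | Next a => witnessed a (f x) (h - 1)
  | Dia a => exists n : nat, witnessed a (Nat.iter n f x) (h - Z.of_nat n)
  end.

(** One witnessing time suffices for a true [Dia], so a finite horizon is enough. Asking for all
    larger [h] lets thresholds be merged by [Z.max]. *)
Lemma sem_witnessed phi x :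
  sem V phi x -> exists h0, forall h, h0 <= h -> witnessed phi x h.
Proof.
  revert x; induction phi as [|p|a IHa b IHb|a IHa b IHb|a IHa b IHb|a IHa|a IHa];
    intros x H.
  - destruct H.
  - exists 1. intros h Hh. split; [exact H | lia].
  - destruct H as [Ha Hb].
    destruct (IHa _ Ha) as [h1 H1], (IHb _ Hb) as [h2 H2].
    exists (Z.max h1 h2). intros h Hh. split; [apply H1 | apply H2]; lia.
  - destruct H as [H|H]; [destruct (IHa _ H) as [h0 H0] | destruct (IHb _ H) as [h0 H0]];
      exists h0; intros h Hh; simpl; auto.
  - destruct (classic (sem V b x)) as [Hb|Hb].
    + destruct (IHb _ Hb) as [h0 H0]. exists (Z.max h0 1). intros h Hh.
      split; [exact H|]. split; [lia|]. intros _. apply H0. lia.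
    + exists 1. intros h Hh. split; [exact H|]. split; [lia|]. intros Hb'. now destruct Hb.
  - destruct (IHa _ H) as [h0 H0]. exists (h0 + 1). intros h Hh. apply H0. lia.
  - destruct H as [n H]. destruct (IHa _ H) as [h0 H0].
    exists (h0 + Z.of_nat n). intros h Hh. exists n. apply H0. lia.
Qed.

Lemma orbit_witnessed (l : list form) x n :
  exists h0, forall h, h0 <= h -> forall i, (i < n)%nat -> forall s, In s l ->
    sem V s (Nat.iter i f x) -> witnessed s (Nat.iter i f x) (h - Z.of_nat i).
Proof.
  induction n as [|n [h1 H1]].
  - exists 0. lia.
  - assert (exists h0, forall h, h0 <= h -> forall s, In s l ->
      sem V s (Nat.iter n f x) -> witnessed s (Nat.iter n f x) h) as [h2 H2].
    { clear. induction l as [|s l [h1 H1]].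
      - exists 0. intros h _ s [].
      - destruct (classic (sem V s (Nat.iter n f x))) as [Hs|Hs].
        + destruct (sem_witnessed _ _ Hs) as [h2 H2].
          exists (Z.max h1 h2). intros h Hh t [<-|Ht] Hsem.
          * apply H2; lia.
          * apply H1; auto; lia.
        + exists h1. intros h Hh t [<-|Ht] Hsem; [now destruct Hs | auto]. }
    exists (Z.max h1 (h2 + Z.of_nat n)). intros h Hh i Hi s Hs Hsem.
    destruct (Nat.eq_dec i n) as [->|Hne].
    + apply H2; auto; lia.
    + apply H1; auto; lia.
Qed.

(** * The poset of points with horizons *)

Context (S : list form).

(** Horizons keep decreasing below [0] instead of stopping there, so that the
    map preserves [h < k] and the order stays antisymmetric. *)
Definition hstep (u : carrier D * Z) : carrier D * Z := (f (fst u), snd u - 1).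

Definition hlt (u v : carrier D * Z) : Prop :=
  snd u < snd v /\
  forall i, Z.of_nat i < snd u -> forall s, In s S ->
    let x := Nat.iter i f (fst u) in
    let y := Nat.iter i f (fst v) in
    (sem V s x -> sem V s y) /\
    (sem V s y -> witnessed s y (snd v - Z.of_nat i)).

Definition hle (u v : carrier D * Z) : Prop := u = v \/ hlt u v.

(** Transitivity: truth transfer composes over the shorter horizon, and the witnessing condition
    constrains only the upper point. *)
Lemma hle_partial_order : partial_order hle.
Proof.
  split; [|split].
  - now left.
  - intros u v [|[Huv _]] [|[Hvu _]]; auto; lia.
  - intros u v w [<-|[H1 H2]] [<-|[H3 H4]]; try (now left); right; split; auto; try lia.
    intros i Hi s Hs. destruct (H2 i Hi s Hs) as [A _].
    assert (Hi' : Z.of_nat i < snd v) by lia.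
    destruct (H4 i Hi' s Hs) as [B C]. auto.
Qed.

Lemma hstep_mono u v : hle u v -> hle (hstep u) (hstep v).
Proof.
  intros [<-|[H1 H2]]; [now left|]. right. split; [simpl; lia|].
  intros i Hi s Hs. simpl in *.
  (* Step [i] after the map is step [i + 1] before it. *)
  specialize (H2 (Datatypes.S i) ltac:(lia) s Hs). cbv zeta in *.
  rewrite !Nat.iter_succ_r in H2.
  replace (snd v - 1 - Z.of_nat i) with (snd v - Z.of_nat (Datatypes.S i)) by lia.
  exact H2.
Qed.

Lemma iter_hstep n x h : Nat.iter n hstep (x, h) = (Nat.iter n f x, h - Z.of_nat n).
Proof.
  induction n as [|n IH].
  - simpl. f_equal. lia.
  - rewrite !Nat.iter_succ, IH. unfold hstep; cbn [fst snd]. f_equal. lia.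
Qed.

Definition hle_topology : topology (carrier D * Z).
Proof.
  refine (@Topology _ (upset hle) _ _ _ _); unfold upset; [firstorder.. |].
  intros F HF u v Huv (U & FU & Uu). exists U. split; [exact FU | exact (HF U FU u v Huv Uu)].
Defined.

Definition hsystem : dsystem.
Proof.
  refine (@DSystem _ hle_topology hstep _).
  intros U HU u v Huv. exact (HU _ _ (hstep_mono _ _ Huv)).
Defined.

Lemma hsystem_dynamic_poset : dynamic_poset hsystem.
Proof.
  exists hle. split; [exact hle_partial_order|]. split; [|exact hstep_mono].
  intros U. reflexivity.
Qed.

(** Variables outside [S] are not monotone along [hle], hence made false. *)
Definition hval : valuation hsystem :=
  fun p u => In (Var p) S /\ 0 < snd u /\ V p (fst u).

Lemma hval_open : open_valuation hval.
Proof.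
  intros p u v [<-|[H1 H2]]; [auto|]. intros (Hp & H0 & Hu).
  split; [exact Hp|]. split; [lia|].
  exact (proj1 (H2 0%nat H0 (Var p) Hp) Hu).
Qed.

Lemma exists_above (oV : open_valuation V) a b x h :
  ~ sem V (Imp a b) x ->
  exists y k, hle (x, h) (y, k) /\ sem V a y /\ witnessed a y k /\ ~ sem V b y.
Proof.
  intros H.
  (* Only truths must persist: preserving falsity need not be an open condition. *)
  set (close := fun y => forall i, (i < Z.to_nat h)%nat -> forall s, In s S ->
    sem V s (Nat.iter i f x) -> sem V s (Nat.iter i f y)).
  assert (Hclose : interior (top D) close x).
  { apply interior_forall_lt. intros i. apply interior_forall_in. intros s _.
    destruct (classic (sem V s (Nat.iter i f x))) as [Hs|Hs].
    - eapply interior_mono; [|exact (interior_preimage_iter _ i _ (sem_interior oV _ _ Hs))].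
      auto.
    - apply interior_full. tauto. }
  assert (exists y, close y /\ sem V a y /\ ~ sem V b y) as (y & Hy & Ha & Hb).
  (* Otherwise the interior of [close] would be a neighbourhood of [x] witnessing [Imp a b]. *)
  { apply NNPP. intros Hno. apply H. revert Hclose. apply interior_mono.
    intros y Hy. destruct (classic (sem V b y)) as [|Hb]; [now right|].
    left. intros Ha. apply Hno. eauto. }
  destruct (sem_witnessed _ _ Ha) as [k1 H1].
  destruct (orbit_witnessed S y (Z.to_nat h)) as [k2 H2].
  (* [h + 1] gives strictness, [k1] witnesses [a] at [y], and [k2] serves the first [h] steps of the
     orbit of [y]. *)
  exists y, (Z.max (h + 1) (Z.max k1 k2)).
  split; [|split; [exact Ha|split; [apply H1; lia|exact Hb]]].
  right. split; [simpl; lia|]. simpl. intros i Hi s Hs. split.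
  - apply Hy; auto; lia.
  - apply H2; auto; lia.
Qed.

(** The two implications do not merge into an equivalence, since short horizons forget truths. In
    the [Imp] case each direction uses the opposite one for [a]. *)
Lemma truth (oV : open_valuation V)
  (Scl : forall s t, In s S -> In t (subforms s) -> In t S) phi :
  In phi S -> forall x h,
  (sem hval phi (x, h) -> sem V phi x) /\ (witnessed phi x h -> sem hval phi (x, h)).
Proof.
  induction phi as [|p|a IHa b IHb|a IHa b IHb|a IHa b IHb|a IHa|a IHa]; intros HS x h.
  1: simpl; tauto.
  1: simpl; unfold hval; simpl; tauto.
  all: assert (HSa : In a S)
    by (apply (Scl _ _ HS); simpl; rewrite ?in_app_iff; auto using subforms_refl);
    specialize (IHa HSa).
  1-3: assert (HSb : In b S)
    by (apply (Scl _ _ HS); simpl; rewrite ?in_app_iff; auto using subforms_refl);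
    specialize (IHb HSb).
  - destruct (IHa x h), (IHb x h). simpl. tauto.
  - destruct (IHa x h), (IHb x h). simpl. tauto.
  - split.
    + intros (U & oU & Ux & UA). apply NNPP. intros H.
      destruct (exists_above oV a b x h H) as (y & k & Hle & _ & Ha & Hb).
      destruct (UA (y, k) (oU _ _ Hle Ux)) as [N|N].
      * apply N, IHa, Ha.
      * apply Hb, (IHb y k), N.
    + intros (Hx & Hh & Hb). exists (hle (x, h)). split; [|split].
      * intros u v Huv Hu. exact (proj2 (proj2 hle_partial_order) _ _ _ Hu Huv).
      * now left.
      * intros [y k] Hle.
        destruct (classic (sem hval a (y, k))) as [Ha|Ha]; [right | now left].
        apply IHa in Ha. apply IHb.
        assert (Hsem : sem V (Imp a b) y -> sem V b y).
        { intros (U & _ & Uy & UA). destruct (UA y Uy); tauto. }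
        (* At [(x, h)] itself the last conjunct of [witnessed] applies; strictly above, step 0
           carries [Imp a b] to [y] and witnesses [b] there. *)
        destruct Hle as [E|[_ H]].
        -- injection E as <- <-. auto.
        -- specialize (H 0%nat Hh). simpl in H. rewrite Z.sub_0_r in H.
           exact (proj2 (H b HSb) (Hsem (proj1 (H (Imp a b) HS) Hx))).
  - exact (IHa (f x) (h - 1)).
  - split; intros [n Hn]; exists n; cbn [hsystem dmap] in *;
      rewrite ?iter_hstep in *; now apply IHa in Hn || apply IHa.
Qed.

End Horizon.

Theorem theorem10p10 : forall phi : form,
  (satisfiable_in dynamic_poset phi <-> satisfiable_in all_systems phi) /\
  (falsifiable_in dynamic_poset phi <-> falsifiable_in all_systems phi).
Proof.
  intros phi. split; split.
  - intros (D & _ & H). now exists D.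
  - intros (D & _ & V & oV & x & Hx).
    destruct (sem_witnessed D V phi x Hx) as [h H].
    exists (hsystem D V (subforms phi)). split; [apply hsystem_dynamic_poset|].
    exists (hval D V (subforms phi)). split; [apply hval_open|].
    exists (x, h). apply truth; auto using subforms_refl, Z.le_refl.
    intros s t. apply subforms_trans.
  - intros (D & _ & H). now exists D.
  - intros (D & _ & V & oV & x & Hx).
    exists (hsystem D V (subforms phi)). split; [apply hsystem_dynamic_poset|].
    exists (hval D V (subforms phi)). split; [apply hval_open|].
    (* Any horizon would do, as falsity at [x] persists at every one. *)
    exists (x, 0). intros H. apply Hx. revert H. apply truth; auto using subforms_refl.
    intros s t. apply subforms_trans.
Qed.
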